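(* Assume $c=1$, i.e. $a^{ij}b_ib_j=-1$. Let $\zeta(x,y)$ be given by $$\zeta^m=\Bigl[h\,v^m-\bigl(b+\tfrac12 g q\bigr)b^m\Bigr]\frac{J}{\varkappa h},\qquad v^m=y^m+b\,b^m,\qquad \varkappa=\frac1h|F^2|^{(1-h)/2},$$ and let $S^2(x,\zeta)=a_{ij}(x)\zeta^i\zeta^j$. Then, for every $y$ in the time-like or in the space-like sector of $T_xM$, $$|F^2(x,y)|^{h(x)}=|S^2(x,\zeta(x,y))| .$$
   Context: Let $M$ be an $N$-dimensional smooth manifold with a pseudo-Riemannian metric tensor $a_{ij}(x)$ of signature $(+,-,\dots,-)$ and inverse $a^{ij}$, a 1-form $b_i(x)$ with $a^{ij}b_ib_j=-1$, and a scalar field $g(x)$. Put $b^i=a^{ij}b_j$. For $y\in T_xM$ put $$b=b_i(x)y^i,\quad r_{ij}=a_{ij}+b_ib_j,\quad \gamma=r_{ij}y^iy^j,\quad q=\sqrt{|\gamma|},\quad B=\gamma-g\,b\,q-b^2 .$$ Time-like sector ($\epsilon=1$, any real $g$): the $y$ with $\gamma>0$ and $B>0$. There $h=\sqrt{1+g^2/4}$, $G=g/h$, $g_\pm=-\frac12g\pm h$, $B=(b-g_-q)(g_+q-b)$ and $J=\left(\frac{b-g_-q}{g_+q-b}\right)^{-G/4}$. Space-like sector ($\epsilon=-1$, $-2<g<2$): the $y$ with $\gamma<0$ (so $B=-(q^2+gbq+b^2)<0$). There $h=\sqrt{1-g^2/4}$, $G=g/h$, $L=q+\frac g2 b$, $J=e^{-\frac12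 G f}$ with $f=-\arctan\frac G2+\arctan\frac{L}{hb}$ if $b<0$, $f=-\pi-\arctan\frac G2+\arctan\frac{L}{hb}$ if $b>0$ and, by continuity, $f=-\frac\pi2-\arctan\frac G2$ if $b=0$. In both sectors $F^2=BJ^2$. *)

(* Defs.v *)
From HB Require Import structures.
From mathcomp Require Import all_boot all_order all_algebra.
From mathcomp Require Import all_classical all_reals all_analysis.
Set Implicit Arguments.
Unset Strict Implicit.
Unset Printing Implicit Defensive.
Import Order.TTheory GRing.Theory Num.Theory.
Import numFieldNormedType.Exports.
Local Open Scope classical_set_scope.
Local Open Scope ring_scope.

Definition partial (R : realType) (N : nat) (k : 'I_N) (f : 'rV[R]_N -> R) :
    'rV[R]_N -> R :=
  'D_(delta_mx 0 k) f.

(* C^oo on U: every iterated partial derivative is differentiable at every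
   point of U.  Meant for open U, where it only depends on f restricted to U. *)
Definition smooth_on (R : realType) (N : nat) (U : set 'rV[R]_N)
    (f : 'rV[R]_N -> R) : Prop :=
  forall (s : seq 'I_N) (u : 'rV[R]_N), U u ->
    differentiable (foldr (@partial R N) f s) u.

(* An N-dimensional smooth manifold given by a smooth atlas: [coord i] is a
   homeomorphism from the open set [dom i] onto an open subset of R^N, with
   inverse [param i]; the values of [coord i] outside [dom i] and of [param i]
   outside of the image are irrelevant. *)
Record smoothManifold (R : realType) (N : nat) := SmoothManifold {
  carrier :> topologicalType;
  carrier_hausdorff : hausdorff_space carrier;
  carrier_second_countable : @second_countable carrier;
  chart : Type;
  dom : chart -> set carrier;
  coord : chart -> carrier -> 'rV[R]_N;
  param : chart -> 'rV[R]_N -> carrier;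
  dom_open : forall i, open (dom i);
  dom_cover : forall p, exists i, dom i p;
  coordK : forall i p, dom i p -> param i (coord i p) = p;
  image_open : forall i, open (coord i @` dom i);
  coord_continuous : forall i p, dom i p -> {for p, continuous (coord i)};
  param_continuous : forall i u, (coord i @` dom i) u ->
    {for u, continuous (param i)};
  transition_smooth : forall i j k,
    smooth_on (coord i @` (dom i `&` dom j))
      (fun u => coord j (param i u) 0 k)
}.

(* Entry (k, l) is d x_j^k / d x_i^l at p. *)
Definition jacobian_mx (R : realType) (N : nat) (M : smoothManifold R N)
    (i j : chart M) (p : M) : 'M[R]_N :=
  \matrix_(k, l)
    partial l (fun u => coord j (param i u) 0 k) (coord i p).

(* Symmetric of signature (+,-,...,-): the rows of P are a basis in which the
   quadratic form is diag(1,-1,...,-1). *)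
Definition lorentzian (R : realType) (N : nat) (A : 'M[R]_N) : Prop :=
  A^T = A /\
  exists2 P : 'M[R]_N, P \in unitmx &
    P *m A *m P^T = diag_mx (\row_k (if k == 0%N :> nat then 1 else -1)).

(* Tensor fields are families of components, one for each chart, subject to
   the transformation law on overlaps; [met i p k l] is a_{kl}(p) in the
   chart i, and it is meaningful only for p in [dom i]. *)
Record metric_field (R : realType) (N : nat) (M : smoothManifold R N) :=
  MetricField {
  met :> chart M -> M -> 'M[R]_N;
  met_smooth : forall i k l,
    smooth_on (coord i @` dom i) (fun u => met i (param i u) k l);
  met_transform : forall i j p, dom i p -> dom j p ->
    met i p = (jacobian_mx i j p)^T *m met j p *m jacobian_mx i j p;
  met_signature : forall i p, dom i p -> lorentzian (met i p)
}.

Record one_form (R : realType) (N : nat) (M : smoothManifold R N) := OneForm {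
  form :> chart M -> M -> 'rV[R]_N;
  form_smooth : forall i k,
    smooth_on (coord i @` dom i) (fun u => form i (param i u) 0 k);
  form_transform : forall i j p, dom i p -> dom j p ->
    form i p = form j p *m jacobian_mx i j p
}.

Record scalar_field (R : realType) (N : nat) (M : smoothManifold R N) :=
  ScalarField {
  scal :> M -> R;
  scal_smooth : forall i,
    smooth_on (coord i @` dom i) (fun u => scal (param i u))
}.

(* In the following, all the objects live at a fixed point and are expressed
   in a fixed chart: a is the matrix of a_{ij}, b the row of the b_i, g the
   value of the scalar field, y the row of the components y^i. *)

(* a^{ij} b_i b_j *)
Definition form_sqnorm (R : realType) (N : nat) (a : 'M[R]_N) (b : 'rV[R]_N) :
    R :=
  \sum_i \sum_j invmx a i j * b 0 i * b 0 j.

(* b^m = a^{mj} b_j *)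
Definition raise (R : realType) (N : nat) (a : 'M[R]_N) (b : 'rV[R]_N) :
    'rV[R]_N :=
  \row_m \sum_j invmx a m j * b 0 j.

(* The scalar b = b_i y^i. *)
Definition bval (R : realType) (N : nat) (b y : 'rV[R]_N) : R :=
  \sum_i b 0 i * y 0 i.

Definition gam (R : realType) (N : nat) (a : 'M[R]_N) (b y : 'rV[R]_N) : R :=
  \sum_i \sum_j (a i j + b 0 i * b 0 j) * y 0 i * y 0 j.

Definition qval (R : realType) (N : nat) (a : 'M[R]_N) (b y : 'rV[R]_N) : R :=
  Num.sqrt `|gam a b y|.

Definition Bval (R : realType) (N : nat) (a : 'M[R]_N) (b : 'rV[R]_N) (g : R)
    (y : 'rV[R]_N) : R :=
  gam a b y - g * bval b y * qval a b y - bval b y ^+ 2.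

Variant sector_kind := TimeLike | SpaceLike.

Definition eps (R : realType) (s : sector_kind) : R :=
  match s with TimeLike => 1 | SpaceLike => -1 end.

(* The space-like sector is considered only where -2 < g < 2. *)
Definition in_sector (R : realType) (N : nat) (s : sector_kind)
    (a : 'M[R]_N) (b : 'rV[R]_N) (g : R) (y : 'rV[R]_N) : Prop :=
  match s with
  | TimeLike => 0 < gam a b y /\ 0 < Bval a b g y
  | SpaceLike => -2 < g < 2 /\ gam a b y < 0
  end.

Definition hval (R : realType) (s : sector_kind) (g : R) : R :=
  Num.sqrt (1 + eps R s * (g ^+ 2 / 4)).

Definition Gval (R : realType) (s : sector_kind) (g : R) : R := g / hval s g.

Definition gplus (R : realType) (g : R) : R := - (g / 2) + hval TimeLike g.
Definition gminus (R : realType) (g : R) : R := - (g / 2) - hval TimeLike g.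

Definition Lval (R : realType) (N : nat) (a : 'M[R]_N) (b : 'rV[R]_N) (g : R)
    (y : 'rV[R]_N) : R :=
  qval a b y + g / 2 * bval b y.

Definition fval (R : realType) (N : nat) (a : 'M[R]_N) (b : 'rV[R]_N) (g : R)
    (y : 'rV[R]_N) : R :=
  let G := Gval SpaceLike g in
  let h := hval SpaceLike g in
  let L := Lval a b g y in
  let by_ := bval b y in
  if by_ < 0 then - atan (G / 2) + atan (L / (h * by_))
  else if 0 < by_ then - pi - atan (G / 2) + atan (L / (h * by_))
  else - (pi / 2) - atan (G / 2).

(* In the time-like sector the base of the real power [`^] is positive. *)
Definition Jval (R : realType) (N : nat) (s : sector_kind)
    (a : 'M[R]_N) (b : 'rV[R]_N) (g : R) (y : 'rV[R]_N) : R :=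
  match s with
  | TimeLike =>
      ((bval b y - gminus g * qval a b y) / (gplus g * qval a b y - bval b y))
        `^ (- (Gval TimeLike g / 4))
  | SpaceLike => expR (- (1 / 2 * Gval SpaceLike g * fval a b g y))
  end.

Definition F2 (R : realType) (N : nat) (s : sector_kind)
    (a : 'M[R]_N) (b : 'rV[R]_N) (g : R) (y : 'rV[R]_N) : R :=
  Bval a b g y * Jval s a b g y ^+ 2.

Definition varkappa (R : realType) (N : nat) (s : sector_kind)
    (a : 'M[R]_N) (b : 'rV[R]_N) (g : R) (y : 'rV[R]_N) : R :=
  1 / hval s g * `|F2 s a b g y| `^ ((1 - hval s g) / 2).

(* v^m = y^m + b b^m *)
Definition vvec (R : realType) (N : nat) (a : 'M[R]_N) (b y : 'rV[R]_N) :
    'rV[R]_N :=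
  y + bval b y *: raise a b.

Definition zeta (R : realType) (N : nat) (s : sector_kind)
    (a : 'M[R]_N) (b : 'rV[R]_N) (g : R) (y : 'rV[R]_N) : 'rV[R]_N :=
  \row_m ((hval s g * vvec a b y 0 m
           - (bval b y + 1 / 2 * g * qval a b y) * raise a b 0 m)
          * (Jval s a b g y / (varkappa s a b g y * hval s g))).

(* S^2 = a_{ij} z^i z^j *)
Definition S2 (R : realType) (N : nat) (a : 'M[R]_N) (z : 'rV[R]_N) : R :=
  \sum_i \sum_j a i j * z 0 i * z 0 j.

(* Main.v *)
Require Import Defs.
From mathcomp Require Import all_boot all_order all_algebra.
From mathcomp Require Import all_classical all_reals all_analysis.
From mathcomp Require Import ring lra.
Import Order.TTheory GRing.Theory Num.Theory.
Import numFieldNormedType.Exports.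
Local Open Scope classical_set_scope.
Local Open Scope ring_scope.

(** The vectors v and b^m are a-orthogonal, with a(v, v) = gamma = epsilon q^2
   and a(b^m, b^m) = -1.  As h^2 = 1 + epsilon g^2/4, this gives
   a(hv - (b + gq/2) b^m, hv - (b + gq/2) b^m) = h^2 gamma - (b + gq/2)^2 = B,
   so that S^2 = F^2 / (varkappa h)^2 = F^2 / |F^2|^(1-h).  The claim follows
   because B and J do not vanish on the sectors. *)

(** The diagonal form has determinant a product of factors 1 and -1, and every factor of an
    invertible product of square matrices is invertible. *)
Lemma lorentzian_unitmx (R : realType) (N : nat) (A : 'M[R]_N) :
  lorentzian A -> A \in unitmx.
Proof.
case=> _ [P Pu PAP].
have : P *m A *m P^T \in unitmx.
  rewrite PAP unitmxE det_diag unitfE; apply/prodf_neq0 => k _.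
  by rewrite mxE; case: ifP => _; rewrite ?oppr_eq0 oner_neq0.
by rewrite !unitmx_mul unitmx_tr Pu andbT.
Qed.

Lemma raiseE (R : realType) (N : nat) (a : 'M[R]_N) (b : 'rV[R]_N) :
  raise a b = b *m (invmx a)^T.
Proof.
apply/rowP => m; rewrite !mxE; apply: eq_bigr => j _.
by rewrite mxE mulrC.
Qed.

Lemma bvalE (R : realType) (N : nat) (b y : 'rV[R]_N) :
  bval b y = (b *m y^T) 0 0.
Proof. by rewrite mxE; apply: eq_bigr => j _; rewrite mxE. Qed.

Lemma S2E (R : realType) (N : nat) (a : 'M[R]_N) (z : 'rV[R]_N) :
  S2 a z = (z *m a *m z^T) 0 0.
Proof.
rewrite /S2 exchange_big mxE; apply: eq_bigr => j _.
rewrite !mxE mulr_suml; apply: eq_bigr => i _.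
by rewrite (mulrC (a i j)).
Qed.

Lemma form_sqnormE (R : realType) (N : nat) (a : 'M[R]_N) (b : 'rV[R]_N) :
  form_sqnorm a b = bval b (raise a b).
Proof.
apply: eq_bigr => i _; rewrite mxE mulr_sumr; apply: eq_bigr => j _.
by rewrite mulrCA mulrA.
Qed.

Lemma gamE (R : realType) (N : nat) (a : 'M[R]_N) (b y : 'rV[R]_N) :
  gam a b y = S2 a y + bval b y ^+ 2.
Proof.
rewrite /gam /S2 expr2 {1}/bval mulr_suml -big_split; apply: eq_bigr => i _.
rewrite /bval mulr_sumr -big_split; apply: eq_bigr => j _ /=.
ring.
Qed.

(** Bilinear expansion: lowering the index of [raise a b] gives back [b], so pairing it with any
    vector through [a] is evaluation of the 1-form. *)
Lemma S2_comb_raise (R : realType) (N : nat) (a : 'M[R]_N) (b y : 'rV[R]_N)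
    (c d : R) : a^T = a -> a \in unitmx ->
  S2 a (c *: y + d *: raise a b)
  = c ^+ 2 * S2 a y + 2 * c * d * bval b y + d ^+ 2 * form_sqnorm a b.
Proof.
move=> aT au.
have ua : raise a b *m a = b by rewrite raiseE trmx_inv aT mulmxKV.
have yu : y *m a *m (raise a b)^T = (b *m y^T)^T.
  by rewrite -{1}aT -mulmxA -trmx_mul ua trmx_mul trmxK.
rewrite form_sqnormE !bvalE !S2E linearD /= !linearZ /=.
rewrite !mulmxDl !mulmxDr -!scalemxAl -!scalemxAr ua yu.
rewrite !mxE.
ring.
Qed.

Lemma S2_zeta (R : realType) (N : nat) (s : sector_kind) (a : 'M[R]_N)
    (b : 'rV[R]_N) (g : R) (y : 'rV[R]_N) :
  a^T = a -> a \in unitmx -> form_sqnorm a b = -1 ->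
  S2 a (zeta s a b g y)
  = (hval s g ^+ 2 * gam a b y - (bval b y + 1 / 2 * g * qval a b y) ^+ 2)
    * (Jval s a b g y / (varkappa s a b g y * hval s g)) ^+ 2.
Proof.
move=> aT au bb; rewrite gamE.
set c := Jval s a b g y / _; set p := bval b y + _.
(* Substituting v = y + b b^m regroups [zeta] along [y] and b^m. *)
have -> : zeta s a b g y = (c * hval s g) *: y
    + (c * (hval s g * bval b y - p)) *: raise a b.
  by apply/rowP => m; rewrite !mxE -/c -/p; ring.
rewrite S2_comb_raise // bb; ring.
Qed.

Lemma eps_sqr_gt0 {R : realType} {N : nat} {s : sector_kind} {a : 'M[R]_N}
    {b : 'rV[R]_N} {g : R} {y : 'rV[R]_N} : in_sector s a b g y ->
  0 < 1 + eps R s * (g ^+ 2 / 4).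
Proof. by case: s => /= [_|[/andP[? ?] _]]; nra. Qed.

Lemma hval_gt0 {R : realType} {N : nat} {s : sector_kind} {a : 'M[R]_N}
    {b : 'rV[R]_N} {g : R} {y : 'rV[R]_N} : in_sector s a b g y ->
  0 < hval s g.
Proof. by move=> /eps_sqr_gt0; rewrite sqrtr_gt0. Qed.

Lemma hval_sqr {R : realType} {N : nat} {s : sector_kind} {a : 'M[R]_N}
    {b : 'rV[R]_N} {g : R} {y : 'rV[R]_N} : in_sector s a b g y ->
  hval s g ^+ 2 = 1 + eps R s * (g ^+ 2 / 4).
Proof. by move=> /eps_sqr_gt0/ltW; exact: sqr_sqrtr. Qed.

Lemma gam_eps {R : realType} {N : nat} {s : sector_kind} {a : 'M[R]_N}
    {b : 'rV[R]_N} {g : R} {y : 'rV[R]_N} : in_sector s a b g y ->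
  gam a b y = eps R s * qval a b y ^+ 2.
Proof.
rewrite sqr_sqrtr ?normr_ge0//.
case: s => /= -[]; first by move=> /gtr0_norm ->; rewrite mul1r.
by move=> _ /ltr0_norm ->; rewrite mulrN mulN1r opprK.
Qed.

(** Since gamma = epsilon q^2 and epsilon^2 = 1, h^2 gamma = gamma + g^2 q^2 / 4, and the last term
    cancels against the one in the expanded square. *)
Lemma BvalE {R : realType} {N : nat} {s : sector_kind} {a : 'M[R]_N}
    {b : 'rV[R]_N} {g : R} {y : 'rV[R]_N} : in_sector s a b g y ->
  hval s g ^+ 2 * gam a b y - (bval b y + 1 / 2 * g * qval a b y) ^+ 2
  = Bval a b g y.
Proof.
move=> hy; rewrite (hval_sqr hy) /Bval (gam_eps hy).
by case: s hy => _ /=; field.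
Qed.

Lemma Bval_neq0 {R : realType} {N : nat} {s : sector_kind} {a : 'M[R]_N}
    {b : 'rV[R]_N} {g : R} {y : 'rV[R]_N} : in_sector s a b g y ->
  Bval a b g y != 0.
Proof.
case: s => [[_ B0]|hy]; first by rewrite gt_eqF.
have := BvalE hy; have h0 := hval_gt0 hy.
case: hy => _ gam0 <-; rewrite lt_eqF//.
(* Space-like case: h^2 gamma < 0, and a square is subtracted from it. *)
rewrite subr_lt0 (@lt_le_trans _ _ 0) ?sqr_ge0//.
by rewrite pmulr_rlt0 ?exprn_gt0.
Qed.

(** In the time-like sector [BvalE] reads B = (h q)^2 - (b + g q / 2)^2, a difference of squares. *)
Lemma Bval_factor {R : realType} {N : nat} {a : 'M[R]_N} {b : 'rV[R]_N}
    {g : R} {y : 'rV[R]_N} : in_sector TimeLike a b g y ->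
  (bval b y - gminus g * qval a b y) * (gplus g * qval a b y - bval b y)
  = Bval a b g y.
Proof.
by move=> hy; rewrite -(BvalE hy) (gam_eps hy)
  /gminus /gplus /=; field.
Qed.

Lemma Jval_gt0 {R : realType} {N : nat} {s : sector_kind} {a : 'M[R]_N}
    {b : 'rV[R]_N} {g : R} {y : 'rV[R]_N} : in_sector s a b g y ->
  0 < Jval s a b g y.
Proof.
case: s => [hy|_]; last exact: expR_gt0.
have := Bval_factor hy; case: hy => _ B0 BE.
apply: powR_gt0; move: B0; rewrite -BE.
set u := bval b y - _; set v := gplus g * _ - _ => uv0.
have v0 : v != 0 by apply: contraTneq uv0 => ->; rewrite mulr0 ltxx.
(* The quotient has the sign of the product [u * v], which is B > 0; the separate signs of [u] and
   [v] need not be found. *)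
have -> : u / v = u * v / v ^+ 2 by field.
by rewrite divr_gt0// exprn_even_gt0.
Qed.

Theorem mainTheorem8 (R : realType) (N : nat) (M : smoothManifold R N)
    (a : metric_field M) (b : one_form M) (g : scalar_field M)
    (hb : forall (i : chart M) (x : M), dom i x ->
      form_sqnorm (a i x) (b i x) = -1)
    (s : sector_kind) (i : chart M) (x : M) (hx : dom i x) (y : 'rV[R]_N)
    (hy : in_sector s (a i x) (b i x) (g x) y) :
  `|F2 s (a i x) (b i x) (g x) y| `^ hval s (g x)
  = `|S2 (a i x) (zeta s (a i x) (b i x) (g x) y)|.
Proof.
have lor := met_signature a hx; have [aT _] := lor.
have h0 := hval_gt0 hy.
rewrite S2_zeta ?hb ?lorentzian_unitmx// (BvalE hy).
have F0 : 0 < `|F2 s (a i x) (b i x) (g x) y|.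
  rewrite normr_gt0 mulf_neq0 ?(Bval_neq0 hy)//.
  by rewrite expf_neq0// gt_eqF// (Jval_gt0 hy).
(* The prefactor 1/h of [varkappa] absorbs the h in the denominator of [zeta]. *)
have -> : varkappa s (a i x) (b i x) (g x) y * hval s (g x)
    = `|F2 s (a i x) (b i x) (g x) y| `^ ((1 - hval s (g x)) / 2).
  by rewrite /varkappa mulrAC div1r mulVf ?mul1r// gt_eqF.
rewrite expr_div_n mulrA -/(F2 _ _ _ _ _) normf_div.
(* Squaring turns the exponent (1 - h)/2 into 1 - h, and inverting the power turns it into h - 1. *)
rewrite -powR_mulrn ?powR_ge0// -powRrM divfK ?pnatr_eq0//.
rewrite (ger0_norm (powR_ge0 _ _)) -powRN opprB.
(* Writing the bare |F^2| as a first power, the exponents add up to 1 + (h - 1) = h. *)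
by rewrite -{2}(powRr1 (ltW F0)) -powRD ?(gt_eqF F0) ?implybT// addrC subrK.
Qed.
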